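(* Let $T$ be a tree, let $\mu$ be a positive function on $T$, and let $\varphi$ be an injective self-map of $T$. Then $C_\varphi$ is an isometry on $L_\mu^\infty$ if and only if $\varphi$ is surjective and $\frac{\mu(v)}{\mu(\varphi(v))} = 1$ for all $v \in T$.
   Context: A tree $T$ is a locally finite, connected, simply-connected graph, identified as a set with its set of vertices; it is assumed to have no terminal vertices (a vertex is terminal if it has a unique neighbor), hence to be infinite, and it is rooted at a vertex $o$. A function on $T$ is a complex-valued function on the set of vertices. For a positive function $\mu: T \to (0,\infty)$ (the weight), $L_\mu^\infty$ is the Banach space of all functions $f$ on $T$ with $\|f\|_\mu = \sup_{v \in T} \mu(v)|f(v)| < \infty$. For an arbitrary self-map $\varphi$ of (the vertex set of) $T$, the composition operator is $C_\varphi f = f \circ \varphi$. It is an isometry on $L_\mu^\infty$ if it maps $L_\mu^\infty$ into itself and $\|C_\varphi f\|_\mu = \|f\|_\mu$ for all $f \in L_\mu^\infty$ (surjectivity of $C_\varphi$ is not required). *)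

(* Defs.v *)
From HB Require Import structures.
From mathcomp Require Import all_boot all_order all_algebra.
From mathcomp Require Import all_classical all_reals all_analysis.
From mathcomp Require Import complex.

Set Implicit Arguments.
Unset Strict Implicit.
Unset Printing Implicit Defensive.

Import Order.TTheory GRing.Theory Num.Theory.

Local Open Scope classical_set_scope.
Local Open Scope ring_scope.

Record rootedTree := RootedTree {
  vertex :> eqType;
  adj : rel vertex;
  root_vertex : vertex;
  adj_sym : symmetric adj;
  adj_irr : irreflexive adj;
  adj_locally_finite : forall v, finite_set [set w | adj v w];
  adj_connected : forall v w, exists p : seq vertex,
    path adj v p /\ last v p = w;
  (* [ucycle adj [:: v; w]] holds for every edge; a genuine simple cycle has
     at least three vertices. *)
  adj_acyclic : forall c : seq vertex, ucycle adj c -> (size c <= 2)%N;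
  no_terminal : forall v, ~ exists w, [set u | adj v u] = [set w];
  (* Given the other axioms, this only rules out the one-vertex tree. *)
  vertex_infinite : infinite_set [set: vertex]
}.

Section WeightedSpace.
Variables (R : realType) (T : rootedTree).

(* The supremum is taken in the extended reals, so that it is [+oo] on the
   functions outside of the weighted space. *)
Definition munorm (mu : T -> R) (f : T -> R[i]) : \bar R :=
  ereal_sup (range (fun v : T => (mu v * ComplexField.Normc.normc (f v))%:E)).

Definition Linfty (mu : T -> R) : set (T -> R[i]) :=
  [set f | (munorm mu f < +oo)%E].

Definition composition_operator (phi : T -> T) (f : T -> R[i]) : T -> R[i] :=
  f \o phi.

Definition isometry_on_Linfty (mu : T -> R)
    (A : (T -> R[i]) -> (T -> R[i])) : Prop :=
  (forall f, Linfty mu f -> Linfty mu (A f)) /\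
  (forall f, Linfty mu f -> munorm mu (A f) = munorm mu f).

End WeightedSpace.

(* Main.v *)
Require Import Defs.
From mathcomp Require Import all_boot all_order all_algebra.
From mathcomp Require Import all_classical all_reals all_analysis.
From mathcomp Require Import complex.

(** The point masses already detect everything: the mass at [w] has weighted
    norm [mu w].  Pulled back along [phi], it becomes the zero function if [w]
    has no preimage, which an isometry forbids since [mu w > 0]; and if
    [w = phi v], injectivity makes it the mass at [v], so that
    [mu v = mu (phi v)].  Conversely, when [phi] is onto and preserves [mu],
    the norms of [f \o phi] and [f] are suprema of the same set of values,
    enumerated along [phi] for the former. *)

Import Order.TTheory GRing.Theory Num.Theory.

Local Open Scope classical_set_scope.
Local Open Scope ring_scope.

Definition point_mass (R : realType) (T : rootedTree) (w : T) : T -> R[i] :=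
  fun v => if v == w then 1 else 0.

Lemma munorm_point_mass (R : realType) (T : rootedTree) (mu : T -> R)
    (mu_ge0 : forall v : T, 0 <= mu v) (w : T) :
  munorm mu (point_mass R T w) = (mu w)%:E.
Proof.
apply/eqP; rewrite eq_le; apply/andP; split.
  apply: ge_ereal_sup => _ [v _ <-]; rewrite /point_mass lee_fin.
  case: eqVneq => [->|_]; first by rewrite ComplexField.Normc.normc1 mulr1.
  by rewrite ComplexField.Normc.normc0 mulr0.
apply: ereal_sup_ubound; exists w => //.
by rewrite /point_mass eqxx ComplexField.Normc.normc1 mulr1.
Qed.

Lemma munorm0 (R : realType) (T : rootedTree) (mu : T -> R) :
  munorm mu (fun=> 0) = 0%E.
Proof.
rewrite -[RHS]ereal_sup1; congr ereal_sup; apply/seteqP.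
split=> [_ [v _ <-]|_ ->].
  by rewrite ComplexField.Normc.normc0 mulr0.
exists (root_vertex T) => //.
by rewrite ComplexField.Normc.normc0 mulr0.
Qed.

Lemma point_mass_comp_inj (R : realType) (T : rootedTree) (phi : T -> T)
    (phi_inj : injective phi) (v : T) :
  composition_operator phi (point_mass R T (phi v)) = point_mass R T v.
Proof. by apply/funext => u; rewrite /composition_operator /= /point_mass inj_eq. Qed.

Lemma munorm_comp_surj (R : realType) (T : rootedTree) (mu : T -> R)
    (phi : T -> T) (phi_surj : forall w : T, exists v : T, phi v = w)
    (mu_phi : forall v : T, mu (phi v) = mu v) (f : T -> R[i]) :
  munorm mu (composition_operator phi f) = munorm mu f.
Proof.
congr ereal_sup; apply/seteqP; split => _ [v _ <-].
  by exists (phi v); rewrite // mu_phi.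
by have [u <-] := phi_surj v; exists u; rewrite // mu_phi.
Qed.

Theorem theorem5p5 (R : realType) (T : rootedTree) (mu : T -> R)
    (mu_gt0 : forall v : T, 0 < mu v)
    (phi : T -> T) (phi_inj : injective phi) :
  isometry_on_Linfty mu (composition_operator phi) <->
  (forall w : T, exists v : T, phi v = w) /\
  (forall v : T, mu v / mu (phi v) = 1).
Proof.
have norm_mass w := munorm_point_mass R T mu (fun v => ltW (mu_gt0 v)) w.
split=> [[_ iso]|[phi_surj mu_div]].
- have mass_iso w : munorm mu (composition_operator phi (point_mass R T w))
      = (mu w)%:E.
    by rewrite iso ?norm_mass // /Linfty /= norm_mass ltry.
  split=> [w|v].
  + apply: contrapT => no_preimage.
    have mass_comp0 : composition_operator phi (point_mass R T w) = fun=> 0.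
      apply/funext => v; rewrite /point_mass /composition_operator /=.
      by case: eqP => // phi_v; case: no_preimage; exists v.
    have := mass_iso w; rewrite mass_comp0 munorm0 => -[mu_w0].
    by have := mu_gt0 w; rewrite -mu_w0 ltxx.
  + have := mass_iso (phi v).
    rewrite point_mass_comp_inj // norm_mass => -[->].
    by rewrite divff // gt_eqF.
- have mu_phi v : mu (phi v) = mu v.
    by rewrite -[LHS]mul1r -(mu_div v) divfK // gt_eqF.
  by split=> f; rewrite /Linfty /= munorm_comp_surj.
Qed.
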